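(* Let $k$ be a positive even integer, let $m\in\mathbb{N}$, $m\ge 1$, and put $i=\frac{m}{2}$. Let $q$ be a complex number with $0<|q|<1$, and define $$T_n(q) := q^{\frac{2i-1}{2}}\,\frac{\left(q^{\frac{k}{4}-(2i-1)},\,q^{\frac{3k}{4}+(2i-1)};\,q^{k}\right)_\infty}{\left(q^{\frac{k}{4}+(2i-1)},\,q^{\frac{3k}{4}-(2i-1)};\,q^{k}\right)_\infty}=q^{\frac{2i-1}{2}}\,\frac{f\left(-q^{\frac{k}{4}-(2i-1)},-q^{\frac{3k}{4}+(2i-1)}\right)}{f\left(-q^{\frac{k}{4}+(2i-1)},-q^{\frac{3k}{4}-(2i-1)}\right)},$$ where it is assumed that the numerator and the denominator of this quotient are nonzero. Then $$\frac{1}{T_n(q)}-T_n(q)=\frac{\phi\left(q^{\frac{k}{4}}\right) f\left(-q^{2i-1},-q^{\frac{k}{2}-(2i-1)}\right)}{q^{\frac{2i-1}{2}}\,\psi\left(q^{\frac{k}{2}}\right) f\left(-q^{\frac{k}{4}-(2i-1)},-q^{\frac{k}{4}+(2i-1)}\right)}$$ and $$\frac{1}{T_n(q)}+T_n(q)=\frac{\phi\left(-q^{\frac{k}{4}}\right) f\left(q^{2i-1},q^{\frac{k}{2}-(2i-1)}\right)}{q^{\frac{2i-1}{2}}\,\psi\left(q^{\frac{k}{2}}\right) f\left(-q^{\frac{k}{4}-(2i-1)},-q^{\frac{k}{4}+(2i-1)}\right)}.$$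
   Context: For complex $\lambda$ and $|q|<1$, $(\lambda;q)_\infty=\prod_{n\ge 0}(1-\lambda q^n)$ and $(\lambda_1,\dots,\lambda_r;q)_\infty=\prod_{j=1}^r(\lambda_j;q)_\infty$. Ramanujan's general theta function is $f(a,b)=\sum_{n=-\infty}^{\infty}a^{n(n+1)/2}b^{n(n-1)/2}$ for $|ab|<1$; by Jacobi's triple product identity $f(a,b)=(-a;ab)_\infty(-b;ab)_\infty(ab;ab)_\infty$. Special cases: $\phi(q)=f(q,q)=\sum_{n=-\infty}^\infty q^{n^2}$ and $\psi(q)=f(q,q^3)=\sum_{n=0}^\infty q^{n(n+1)/2}$. A fourth root $q^{1/4}$ of $q$ is fixed once and for all, and every power $q^{r/4}$ with $r\in\mathbb{Z}$ means $(q^{1/4})^r$. The subscript $n$ in $T_n$ is only a label; the function depends on $k$ and $i$. *)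

(* Defs.v *)
From HB Require Import structures.
From mathcomp Require Import all_boot all_order all_algebra complex.
From mathcomp Require Import all_classical all_reals all_analysis.
Set Implicit Arguments.
Unset Strict Implicit.
Unset Printing Implicit Defensive.
Import Order.TTheory GRing.Theory Num.Theory numFieldNormedType.Exports.
Local Open Scope classical_set_scope.
Local Open Scope ring_scope.

(* Everything is stated over an arbitrary numFieldType K, whose topology is the
   one of its norm; the intended instance is K = R[i] with R : realType.  Limits
   are total: [lim] returns a default value on a divergent sequence. *)

Definition qpoch (K : numFieldType) (a q : K) : K :=
  limn (fun N : nat => \prod_(0 <= n < N) (1 - a * q ^+ n) : K).

Definition qpochs (K : numFieldType) (s : seq K) (q : K) : K :=
  \prod_(a <- s) qpoch a q.

(* Sum over all n : int of u n, as the sum over n >= 0 plus the sum over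
   n <= -1. *)
Definition bilateral_sum (K : numFieldType) (u : int -> K) : K :=
  limn (series (fun n : nat => u n%:Z)) +
  limn (series (fun n : nat => u (- n.+1%:Z))).

(* The integer divisions by 2 are exact and both exponents are nonnegative. *)
Definition theta (K : numFieldType) (a b : K) : K :=
  bilateral_sum (fun n : int =>
    a ^ ((n * (n + 1)) %/ 2)%Z * b ^ ((n * (n - 1)) %/ 2)%Z).

Definition phi (K : numFieldType) (q : K) : K := theta q q.

Definition psi (K : numFieldType) (q : K) : K := theta q (q ^+ 3).

(* [qpow w s] is the power q^s, where w is the chosen fourth root of q and s
   is an element of (1/4)Z: q^(r/4) = w^r.  The floor only serves to turn the
   integral rational 4s into an int, see [qpow_quarter]; the value is
   meaningless for other s. *)
Definition qpow (K : numFieldType) (w : K) (s : rat) : K :=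
  w ^ Num.floor (4 * s).

Lemma qpow_quarter (K : numFieldType) (w : K) (r : int) :
  qpow w (r%:~R / 4) = w ^ r.
Proof. by rewrite /qpow mulrC divfK // intrKfloor. Qed.

(* T_num and T_den are the numerator and denominator of the quotient of infinite
   products in T_n(q), without the prefactor q^((2i-1)/2); q = w^4 enters
   through the base [qpow w k%:Q] = q^k. *)
Definition T_num (K : numFieldType) (w : K) (k : nat) (i : rat) : K :=
  qpochs [:: qpow w (k%:Q / 4 - (2 * i - 1));
             qpow w (3 * k%:Q / 4 + (2 * i - 1))] (qpow w k%:Q).

Definition T_den (K : numFieldType) (w : K) (k : nat) (i : rat) : K :=
  qpochs [:: qpow w (k%:Q / 4 + (2 * i - 1));
             qpow w (3 * k%:Q / 4 - (2 * i - 1))] (qpow w k%:Q).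

Definition T (K : numFieldType) (w : K) (k : nat) (i : rat) : K :=
  qpow w ((2 * i - 1) / 2) * (T_num w k i / T_den w k i).

(* Main.v *)
(* The identities are equalities of double series.  Put Q = q^(k/4) and
   z = q^(2i-1), let D and N be the theta functions in the denominator and the
   numerator of T, and expand them with y = -z and s = 1 or s = -1:
     D = sum y^n Q^(2n^2-n),  N = sum y^(-n) Q^(2n^2-n).
   In the double series of theta(sQ, sQ) theta(sy, sQ^2/y), indexed by pairs
   (r, t), the terms with r + t even, (r, t) = (m-n, m+n), add up to D^2, and
   those with r + t odd, (r, t) = (m-n, 1-m-n), add up to s y N^2.  Splitting
   the double series of D N by the parity of m + n likewise gives
   D N = psi(Q^2) theta(Q/y, Qy).  Since 1/T -+ T = (D^2 -+ z N^2)/(z^(1/2) D N),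
   this proves both formulas.  The product form of T is Jacobi's triple product,
   obtained by dominated convergence from its finite form
     prod_(j<N) (1 + a p^j)(1 + b p^j)
       = sum_n (p;p)_(2N) / ((p;p)_(N+n) (p;p)_(N-n)) a^(n(n+1)/2) b^(n(n-1)/2)
   with p = ab. *)
Require Import Defs.
From HB Require Import structures.
From mathcomp Require Import all_boot all_order all_algebra complex finmap.
From mathcomp Require Import ring lra zify.
From mathcomp Require Import all_classical all_reals all_analysis.
From mathcomp Require Import showcase.summability.
Set Implicit Arguments.
Unset Strict Implicit.
Unset Printing Implicit Defensive.
Import Order.TTheory GRing.Theory Num.Theory numFieldNormedType.Exports.
Local Open Scope ring_scope.

(* Unconditional summation over an arbitrary index type *)
#[local] Existing Instance totally_filter.

(** The limit is taken along the finite subsets directed by inclusion. No enumeration of the indices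
    enters, so double series over [int * int] can be reindexed and split freely. *)
Definition has_sum (K : numFieldType) (I : choiceType) (u : I -> K) (s : K) :=
  ((fun A : {fset I} => \sum_(i <- A) u i) @ totally --> s)%classic.

Definition abs_summable (K : numFieldType) (I : choiceType) (u : I -> K) :=
  exists M : K, forall A : {fset I}, \sum_(i <- A) `|u i| <= M.

Lemma totally_ge (I : choiceType) (A : {fset I}) :
  totally (fun B : {fset I} => (A `<=` B)%fset).
Proof. by exists A. Qed.

(** This reduces each rearrangement below to a cofinality check: images, unions of images,
    rectangles and initial segments eventually contain any given finite set. *)
Lemma cvg_totally (T : Type) (F : set_system T) {FF : Filter F}
    (I : choiceType) (h : T -> {fset I}) :
  (forall A : {fset I}, F (fun x => (A `<=` h x)%fset)) ->
  (h @ F --> totally)%classic.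
Proof.
move=> hF P; rewrite nbhs_filterE => -[A _ AP].
by apply: (@filterS _ F _ [set x | (A `<=` h x)%fset]%classic _ _ (hF A)) => x /AP.
Qed.

Section HasSum.
Variables (K : numFieldType) (I : choiceType).
Implicit Types (u v : I -> K) (s t : K).

Lemma has_sum_eq u v s : u =1 v -> has_sum u s -> has_sum v s.
Proof. by move=> /funext ->. Qed.

Lemma has_sumD u v s t :
  has_sum u s -> has_sum v t -> has_sum (fun i => u i + v i) (s + t).
Proof.
move=> us vt; rewrite /has_sum; under eq_fun do rewrite big_split.
exact: cvgD.
Qed.

Lemma has_sumZ c u s : has_sum u s -> has_sum (fun i => c * u i) (c * s).
Proof.
move=> us; rewrite /has_sum; under eq_fun do rewrite -mulr_sumr.
exact: cvgMr.
Qed.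
End HasSum.

Lemma abs_summable_comp (K : numFieldType) (I J : choiceType) (h : J -> I)
    (u : I -> K) :
  injective h -> abs_summable u -> abs_summable (u \o h).
Proof.
move=> hI [M uM]; exists M => A.
rewrite (le_trans _ (uM (h @` A)%fset))// big_imfset//=.
by move=> x y _ _; exact: hI.
Qed.

Lemma sum_fsetD (V : zmodType) (I : choiceType) (u : I -> V) (A B : {fset I}) :
  (A `<=` B)%fset ->
  \sum_(i <- B) u i - \sum_(i <- A) u i = \sum_(i <- (B `\` A)%fset) u i.
Proof.
move=> AB; rewrite [X in X - _](big_fsetID _ (mem A))/=.
rewrite (@eq_fbigl _ _ _ _ [fset x in B | x \in A]%fset A); last first.
  move=> x; rewrite !inE/= andbC; case: (boolP (x \in A)) => //= xA.
  exact: (fsubsetP AB).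
rewrite addrAC subrr add0r; apply: eq_fbigl => x.
by rewrite !inE/= andbC.
Qed.

Lemma ler_fset_sum (K : numDomainType) (I : choiceType) (u : I -> K)
    (A B : {fset I}) :
  (forall i, 0 <= u i) -> (A `<=` B)%fset ->
  \sum_(i <- A) u i <= \sum_(i <- B) u i.
Proof. by move=> u0 AB; rewrite -subr_ge0 sum_fsetD// sumr_ge0. Qed.

Lemma sum_fsetM (K : comPzRingType) (I J : choiceType) (u : I -> K)
    (v : J -> K) (A : {fset I}) (B : {fset J}) :
  \sum_(p <- (A `*` B)%fset) u p.1 * v p.2 =
  (\sum_(i <- A) u i) * (\sum_(j <- B) v j).
Proof.
rewrite big_distrlr/= -(big_allpairs (F := fun p => u p.1 * v p.2)).
apply: perm_big; apply: uniq_perm; first exact: fset_uniq.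
  by rewrite allpairs_uniq ?fset_uniq// => -[? ?] [? ?].
move=> [x y]; rewrite in_fsetM/=; apply/idP/allpairsP => /=.
  by move=> /andP[xA yB]; exists (x, y).
by move=> [[a b] /= [aA bB [-> ->]]]; rewrite aA.
Qed.

Lemma fsetM_ge (I J : choiceType) (A : {fset I * J}) :
  (A `<=` [fset p.1 | p in A] `*` [fset p.2 | p in A])%fset.
Proof. by apply/fsubsetP => p pA; rewrite in_fsetM !in_imfset. Qed.

(** A finite set of pairs lies in the rectangle of its projections, on which the sum of norms
    factors. *)
Lemma abs_summable_mul (K : numFieldType) (I J : choiceType) (u : I -> K)
    (v : J -> K) :
  abs_summable u -> abs_summable v -> abs_summable (fun p => u p.1 * v p.2).
Proof.
move=> [M uM] [N vN]; exists (M * N) => A.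
apply: (le_trans (ler_fset_sum _ (fsetM_ge A))) => //.
under eq_bigr do rewrite normrM.
rewrite (sum_fsetM (fun i => `|u i|) (fun i => `|v i|)).
by rewrite ler_pM ?sumr_ge0.
Qed.

Lemma has_sum_reindex (K : numFieldType) (I J : choiceType) (h : J -> I)
    (u : I -> K) (s : K) :
  bijective h -> has_sum u s -> has_sum (u \o h) s.
Proof.
move=> [g hK gK] us; rewrite /has_sum.
have hF : ((fun A : {fset J} => (h @` A)%fset) @ totally --> totally)%classic.
  apply: cvg_totally => A; exists (g @` A)%fset => // B /= AB.
  apply/fsubsetP => x xA; rewrite -(gK x) in_imfset//=.
  by apply: (fsubsetP AB); rewrite in_imfset.
have -> : (fun A : {fset J} => \sum_(i <- A) (u \o h) i) =
    (fun A : {fset I} => \sum_(i <- A) u i) \o (fun A => (h @` A)%fset).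
  apply/funext => A /=; rewrite big_imfset//= => x y _ _; exact: can_inj hK _ _.
exact: (cvg_comp _ _ hF us).
Qed.

(** Unions of an image under [h1] and an image under [h2] are cofinal among the finite subsets of
    [I], and on them the partial sum of [u] is a sum of two partial sums. *)
Lemma has_sum_split (K : numFieldType) (I J1 J2 : choiceType) (h1 : J1 -> I)
    (h2 : J2 -> I) (u : I -> K) (s s1 s2 : K) :
  injective h1 -> injective h2 -> (forall x y, h1 x <> h2 y) ->
  (forall i, (exists x, i = h1 x) \/ (exists y, i = h2 y)) ->
  has_sum u s -> has_sum (u \o h1) s1 -> has_sum (u \o h2) s2 -> s = s1 + s2.
Proof.
move=> h1I h2I h12 cov us us1 us2.
pose F := filter_prod (@totally J1) (@totally J2).
pose h (p : {fset J1} * {fset J2}) := (h1 @` p.1 `|` h2 @` p.2)%fset.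
have FF : ProperFilter F by exact: _.
have hF : (h @ F --> totally)%classic.
  apply: cvg_totally => A.
  (* [n] chooses a preimage of each index on one of the two sides; [A1] and [A2] collect the
     preimages of the indices in [A]. *)
  have /boolp.choice[n nP] : forall i, exists c : J1 + J2,
      match c with inl x => i = h1 x | inr y => i = h2 y end.
    by move=> i; have [[x ix]|[y iy]] := cov i; [exists (inl x)|exists (inr y)].
  pose A1 := [fset x in pmap
    (fun i => if n i is inl x then Some x else None) A]%fset.
  pose A2 := [fset y in pmap
    (fun i => if n i is inr y then Some y else None) A]%fset.
  exists ([set B | (A1 `<=` B)%fset], [set B | (A2 `<=` B)%fset])%classic => /=.
    by split; exact: totally_ge.
  move=> [B1 B2] /= [/fsubsetP AB1 /fsubsetP AB2]; apply/fsubsetP => i iA.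
  rewrite in_fsetU; apply/orP; have := nP i; case E : (n i) => [x|y] ->.
    left; rewrite in_imfset//; apply: AB1; rewrite inE mem_pmap.
    by apply/mapP; exists i => //; rewrite E.
  right; rewrite in_imfset//; apply: AB2; rewrite inE mem_pmap.
  by apply/mapP; exists i => //; rewrite E.
have e : (fun A : {fset I} => \sum_(i <- A) u i) \o h =
   (fun p => \sum_(i <- p.1) (u \o h1) i + \sum_(i <- p.2) (u \o h2) i).
  apply/funext => -[A B] /=.
  have P : perm_eq (h (A, B)) ((h1 @` A)%fset ++ (h2 @` B)%fset).
    apply: uniq_perm; first exact: fset_uniq.
      rewrite cat_uniq !fset_uniq/= andbT; apply/hasPn => y /imfsetP[b /= _ ->].
      by apply/negP => /imfsetP[a /= _ /esym/h12].
    by move=> x; rewrite mem_cat in_fsetU.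
  rewrite (perm_big _ P) big_cat/= !big_imfset//= => x y _ _.
    exact: h2I.
  exact: h1I.
have us' := cvg_comp _ _ hF us.
apply: (cvg_unique (@norm_hausdorff _ K^o) us').
rewrite e; apply: cvgD.
  exact: (cvg_comp _ _ (@cvg_fst _ _ (@totally J1) (@totally J2) _) us1).
exact: (cvg_comp _ _ (@cvg_snd _ _ (@totally J1) (@totally J2) _) us2).
Qed.

(** Rectangles are cofinal among the finite sets of pairs, and the sum over a rectangle is a product
    of partial sums. *)
Lemma has_sum_mul (K : numFieldType) (I J : choiceType) (u : I -> K)
    (v : J -> K) (r s t : K) :
  has_sum (fun p => u p.1 * v p.2) r -> has_sum u s -> has_sum v t -> r = s * t.
Proof.
move=> uvr us vt.
pose F := filter_prod (@totally I) (@totally J).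
pose h (p : {fset I} * {fset J}) := (p.1 `*` p.2)%fset.
have FF : ProperFilter F by exact: _.
have hF : (h @ F --> totally)%classic.
  apply: cvg_totally => A.
  exists ([set B | ([fset p.1 | p in A] `<=` B)%fset],
          [set B | ([fset p.2 | p in A] `<=` B)%fset])%classic => /=.
    by split; exact: totally_ge.
  move=> [B1 B2] /= [/fsubsetP AB1 /fsubsetP AB2]; apply/fsubsetP => p pA.
  by rewrite in_fsetM AB1 ?AB2// in_imfset.
have uvr' := cvg_comp _ _ hF uvr.
apply: (cvg_unique (@norm_hausdorff _ K^o) uvr').
have e : (fun A : {fset I * J} => \sum_(p <- A) u p.1 * v p.2) \o h =
    (fun p => (\sum_(i <- p.1) u i) * (\sum_(j <- p.2) v j)).
  by apply/funext => -[A B]; exact: sum_fsetM.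
rewrite e; apply: cvgM.
  exact: (cvg_comp _ _ (@cvg_fst _ _ (@totally I) (@totally J) _) us).
exact: (cvg_comp _ _ (@cvg_snd _ _ (@totally I) (@totally J) _) vt).
Qed.

Lemma has_sum_supp1 (K : numFieldType) (I : choiceType) (u : I -> K) (a : I) :
  (forall i, i != a -> u i = 0) -> has_sum u (u a).
Proof.
move=> ua; apply: cvg_near_cst; exists [fset a]%fset => // A /=.
rewrite fsub1set => aA; rewrite (big_fsetD1 a)//= big1_fset ?addr0// => i.
by rewrite !inE => /andP[/ua].
Qed.

Lemma has_sum_series (K : numFieldType) (u : nat -> K) (s : K) :
  has_sum u s -> (series u @ \oo --> s)%classic.
Proof.
move=> us; pose h n := [fset i in iota 0 n]%fset.
have hF : (h @ \oo --> totally)%classic.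
  apply: cvg_totally => A.
  exists (\max_(i <- A) i.+1)%N => // n /= An; apply/fsubsetP => i iA.
  rewrite inE mem_iota/= add0n; apply: leq_trans An.
  exact: (@leq_bigmax_seq _ _ xpredT succn i).
have -> : series u = (fun A : {fset nat} => \sum_(i <- A) u i) \o h.
  apply/funext => n; rewrite /series/= /index_iota subn0.
  apply: perm_big; apply: uniq_perm; rewrite ?iota_uniq ?fset_uniq//.
  by move=> x; rewrite inE.
exact: (cvg_comp _ _ hF us).
Qed.

(** * Absolute summability and dominated convergence over the complex numbers *)

Lemma cvg_seq_sum (K : numFieldType) (T : Type) (F : set_system T)
    {FF : Filter F} (I : Type) (r : seq I) (f : T -> I -> K) (l : I -> K) :
  (forall i, (f x i @[x --> F] --> l i)%classic) ->
  (\sum_(i <- r) f x i @[x --> F] --> \sum_(i <- r) l i)%classic.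
Proof.
move=> fl; elim: r => [|i r IHr].
  by rewrite big_nil; under eq_fun do rewrite big_nil; exact: cvg_cst.
by rewrite big_cons; under eq_fun do rewrite big_cons; exact: cvgD.
Qed.

Lemma cvgCP (R : realType) (T : Type) (F : set_system T) {FF : Filter F}
    (f : T -> R[i]) (l : R[i]) :
  (f x @[x --> F] --> (l : (R[i] : numFieldType)))%classic <->
  (forall e, 0 < e -> \near F, `|l - f F| <= e).
Proof. exact: (@cvgrPdist_le (R[i] : numFieldType) (R[i] : numFieldType)^o). Qed.

(** Choose [A] whose sum of norms is within [e] of the supremum. A set disjoint from [A] can add at
    most the remaining [e]. Real parts are used because suprema are taken in [R]. *)
Lemma abs_summable_tail (R : realType) (I : choiceType) (u : I -> R[i])
    (e : R[i]) : abs_summable u -> 0 < e ->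
  exists A : {fset I}, forall B : {fset I}, [disjoint A & B]%fset ->
    \sum_(i <- B) `|u i| <= e.
Proof.
move=> [M uM] e0.
pose E := [set complex.Re (\sum_(i <- A) `|u i|) | A in [set: {fset I}]]%classic.
have E0 : has_sup E.
  split; first by exists (complex.Re (\sum_(i <- fset0) `|u i|)), fset0.
  by exists (complex.Re M) => _ [A _ <-]; have := uM A; rewrite lecE => /andP[].
have Re0 : 0 < complex.Re e by move: e0; rewrite ltcE => /andP[].
have [_ [A _ <-] Ae] := sup_adherent Re0 E0.
exists A => B AB.
have UA : complex.Re (\sum_(i <- (A `|` B)%fset) `|u i|) <= sup E.
  by apply: sup_upper_bound => //; exists (A `|` B)%fset.
have := sum_fsetD (fun i => `|u i|) (fsubsetUl A B).
have -> : ((A `|` B) `\` A = B)%fset.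
  by rewrite fsetDUl fsetDv fset0U; apply/fsetDidPl; rewrite fdisjoint_sym.
move=> h; have {h} hr : complex.Re (\sum_(i <- B) `|u i|) <= complex.Re e.
  rewrite -h raddfB/=; lra.
(* Both sides are nonnegative, hence have imaginary part 0, so comparing real parts is enough. *)
have : 0 <= \sum_(i <- B) `|u i| by rewrite sumr_ge0.
move: hr e0; rewrite !lecE ltcE/= => -> /andP[/eqP -> _] /andP[/eqP -> _].
by rewrite eqxx.
Qed.

Lemma complex_cvg (R : realType) (T : Type) (F : set_system T) {FF : Filter F}
    (f : T -> R[i]) (a b : R) :
  (complex.Re (f x) @[x --> F] --> a)%classic ->
  (complex.Im (f x) @[x --> F] --> b)%classic ->
  (f x @[x --> F] --> ((a +i* b)%C : (R[i] : numFieldType)))%classic.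
Proof.
move=> /cvgrPdist_le fa /cvgrPdist_le fb; apply/cvgCP => e e0.
have [r r0 ->] : exists2 r : R, 0 < r & e = (r%:C)%C.
  exists (complex.Re e); first by move: e0; rewrite ltcE => /andP[].
  by rewrite RRe_real// ger0_real// ltW.
near=> x.
have ha : `|a - complex.Re (f x)| <= r / 2 by near: x; apply: fa; lra.
have hb : `|b - complex.Im (f x)| <= r / 2 by near: x; apply: fb; lra.
case: (f x) ha hb => c d /= ha hb.
rewrite normc_def lecE/= eqxx/= -(ger0_norm (ltW r0)) -sqrtr_sqr ler_wsqrtr//.
rewrite -(real_normK (num_real (a - c))) -(real_normK (num_real (b - d))).
have := normr_ge0 (a - c); have := normr_ge0 (b - d); nra.
Unshelve. all: by end_near. Qed.

(** Completeness of [R] is applied to the real and the imaginary parts of the partial sums, which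
    are Cauchy because the tails are small; [g] stands for either part. *)
Lemma abs_summable_has_sum (R : realType) (I : choiceType) (u : I -> R[i]) :
  abs_summable u -> exists s, has_sum u s.
Proof.
move=> us.
suff H (g : R[i] -> R) : (forall x y, g (x - y) = g x - g y) ->
    (forall x, `|g x| <= complex.Re `|x|) ->
    cvg (g (\sum_(i <- A) u i) @[A --> totally])%classic.
  have HRe := H (@complex.Re R) (raddfB _).
  have HIm := H (@complex.Im R) (raddfB _).
  exists (lim (complex.Re (\sum_(i <- A) u i) @[A --> totally])%classic
    +i* lim (complex.Im (\sum_(i <- A) u i) @[A --> totally])%classic)%C.
  apply: complex_cvg.
    apply: HRe => -[x y]; rewrite normc_def/=.
    by rewrite -sqrtr_sqr ler_wsqrtr// lerDl sqr_ge0.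
  apply: HIm => -[x y]; rewrite normc_def/=.
  by rewrite -sqrtr_sqr ler_wsqrtr// lerDr sqr_ge0.
move=> gB gn; apply/cauchy_cvgP; apply: cauchy_exP => e e0.
have [A hA] : exists A : {fset I}, forall B : {fset I}, [disjoint A & B]%fset ->
    \sum_(i <- B) `|u i| <= ((e / 2)%:C)%C.
  by apply: abs_summable_tail => //; rewrite ltcE/= eqxx/= divr_gt0.
exists (g (\sum_(i <- A) u i)), A => // B /= AB.
rewrite /ball/= distrC -gB sum_fsetD//.
apply: (le_lt_trans (gn _)).
have /hA : [disjoint A & (B `\` A)]%fset by apply/fdisjointP => x xA; rewrite !inE xA.
move=> /(le_trans (ler_norm_sum _ _ _)); rewrite lecE => /andP[_ /=]; lra.
Qed.

(** One [e] is the distance from [s] to some partial sum over a set containing [A], the other bounds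
    the terms of that sum outside [A]. *)
Lemma has_sum_tail (K : numFieldType) (I : choiceType) (u g : I -> K)
    (A : {fset I}) (e s : K) :
  (forall i, `|u i| <= `|g i|) -> 0 < e ->
  (forall B : {fset I}, [disjoint A & B]%fset -> \sum_(i <- B) `|g i| <= e) ->
  has_sum u s -> `|s - \sum_(i <- A) u i| <= e + e.
Proof.
move=> ug e0 gA /cvgrPdist_le/(_ _ e0)[B _ /(_ (A `|` B)%fset)/=].
rewrite fsubsetUr => /(_ isT) h.
rewrite -(subrKA (\sum_(i <- (A `|` B)%fset) u i)).
apply: (le_trans (ler_normD _ _)); apply: lerD => //.
rewrite sum_fsetD ?fsubsetUl//; apply: (le_trans (ler_norm_sum _ _ _)).
apply: le_trans (gA ((A `|` B) `\` A)%fset _); first exact: ler_sum.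
by apply/fdisjointP => x xA; rewrite !inE xA.
Qed.

(** Dominated convergence for series: a single finite set [A], chosen from [g], controls the tails
    of [u] and of all [a n] at once, leaving a finite sum to pass to the limit. *)
Lemma tannery (R : realType) (I : choiceType) (a : nat -> I -> R[i])
    (u g : I -> R[i]) (S : nat -> R[i]) (s : R[i]) :
  abs_summable g -> (forall n i, `|a n i| <= `|g i|) ->
  (forall i, `|u i| <= `|g i|) ->
  (forall i, (a n i @[n --> \oo] --> (u i : (R[i] : numFieldType)))%classic) ->
  (forall n, has_sum (a n) (S n)) -> has_sum u s ->
  (S @ \oo --> (s : (R[i] : numFieldType)))%classic.
Proof.
move=> gs ag ug au aS us; apply/cvgCP => e e0.
(* Two fifths go to each of the two tails and one to the finite sum over [A]. *)
have e5 : 0 < e / 5%:R by rewrite divr_gt0.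
have [A gA] := abs_summable_tail gs e5.

have /cvgCP/(_ _ e5) h : ((\sum_(i <- A) a n i) @[n --> \oo] -->
    (\sum_(i <- A) u i : (R[i] : numFieldType)))%classic.
  exact: (@cvg_seq_sum (R[i] : numFieldType)).
near=> n.
have hn : `|\sum_(i <- A) u i - \sum_(i <- A) a n i| <= e / 5%:R by near: n; exact: h.
have h1 := has_sum_tail ug e5 gA us.
have h2 := has_sum_tail (ag n) e5 gA (aS n).
rewrite -(subrKA (\sum_(i <- A) u i)) -[_ - S n](subrKA (\sum_(i <- A) a n i)).
have -> : e = (e / 5%:R + e / 5%:R) + (e / 5%:R + (e / 5%:R + e / 5%:R)) by field.
do 2 (apply: (le_trans (ler_normD _ _)); apply: lerD => //).
by rewrite distrC.
Unshelve. all: by end_near. Qed.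

(** * Summability tests on [nat] and [int] *)

Lemma abs_summable_nat (K : numFieldType) (u : nat -> K) (M : K) :
  (forall n, \sum_(0 <= i < n) `|u i| <= M) -> abs_summable u.
Proof.
move=> uM; exists M => A.
pose n := (\max_(i <- A) i.+1)%N.
apply: le_trans (uM n); rewrite /index_iota subn0.
have -> : \sum_(i <- iota 0 n) `|u i| = \sum_(i <- [fset i in iota 0 n]%fset) `|u i|.
  apply: perm_big; apply: uniq_perm; rewrite ?iota_uniq ?fset_uniq//.
  by move=> x; rewrite inE.
apply: ler_fset_sum => //; apply/fsubsetP => i iA.
rewrite inE mem_iota/= add0n.
exact: (@leq_bigmax_seq _ _ xpredT succn i).
Qed.

Lemma abs_summable_int (K : numFieldType) (u : int -> K) :
  abs_summable (fun n : nat => u n%:Z) ->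
  abs_summable (fun n : nat => u (- n.+1%:Z)) -> abs_summable u.
Proof.
move=> [M uM] [N uN]; exists (M + N) => A.
pose n := (\max_(i <- A) `|i|.+1)%N.
pose B := [fset i in iota 0 n]%fset.
pose C := ([fset i%:Z | i in B] `|` [fset - i.+1%:Z | i in B])%fset.
have AC : (A `<=` C)%fset.
  apply/fsubsetP => i iA; rewrite in_fsetU.
  have : (`|i| < n)%N by exact: (@leq_bigmax_seq _ _ xpredT (fun i : int => `|i|.+1) i).
  case: i {iA} => i ni; apply/orP; [left|right; rewrite NegzE];
    by apply: in_imfset; rewrite inE mem_iota add0n//=; lia.
apply: le_trans (ler_fset_sum _ AC) _ => //.
apply: le_trans (lerD (uM B) (uN B)).
have P : perm_eq C ([fset i%:Z | i in B]%fset ++ [fset - i.+1%:Z | i in B]%fset).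
  apply: uniq_perm; first exact: fset_uniq.
    rewrite cat_uniq !fset_uniq/= andbT; apply/hasPn => y /imfsetP[b /= _ ->].
    by apply/negP => /imfsetP[a /= _]; lia.
  by move=> x; rewrite mem_cat in_fsetU.
by rewrite (perm_big _ P) big_cat/= !big_imfset//= => x y _ _; lia.
Qed.

(** The ratio bound [c * x ^+ n] tends to 0, so it is at most 1/2 from some [n0] on. *)
Lemma abs_summable_ratio (R : realType) (u : nat -> R[i]) (c x : R) :
  0 <= x < 1 -> (forall n, `|u n.+1| <= `|u n| * (c * x ^+ n)%:C%C) ->
  abs_summable u.
Proof.
move=> /andP[x0 x1] hu.
have [n0 hn0] : exists n0, forall n, (n0 <= n)%N -> c * x ^+ n <= 2^-1.
  have : (c * x ^+ n @[n --> \oo] --> c * 0)%classic.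
    by apply: cvgMr; apply: cvg_expr; rewrite ger0_norm.
  rewrite mulr0 => /cvgrPdist_le/(_ 2^-1)[|n0 _ h].
    by rewrite invr_gt0.
  exists n0 => n /h/=; rewrite sub0r normrN; exact: le_trans (ler_norm _).
pose M := \sum_(0 <= i < n0) `|u i| + `|u n0| *+ 2.
(* From [n0] on, the partial sum plus twice the next term does not increase: the step adds [|u n|]
   and replaces [2 |u n|] by [2 |u n.+1| <= |u n|]. *)
suff H k : \sum_(0 <= i < n0 + k) `|u i| + `|u (n0 + k)%N| *+ 2 <= M.
  apply: (@abs_summable_nat _ _ M) => n.
  have [nn0|/ltnW nn0] := leqP n0 n.
    by apply: le_trans (H (n - n0)%N); rewrite subnKC// lerDl mulrn_wge0.
  rewrite /M (big_cat_nat (leq0n n) nn0)//= -addrA lerDl.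
  by rewrite addr_ge0 ?mulrn_wge0// sumr_ge0.
elim: k => [|k IHk]; first by rewrite addn0.
apply: le_trans IHk; rewrite addnS big_nat_recr//= -addrA lerD2l mulr2n.
rewrite [leRHS]mulr2n lerD2l -mulr2n.
have := hu (n0 + k)%N => /(ler_wMn2r 2) h; apply: le_trans h _.
rewrite -mulrnAr -[leRHS]mulr1 ler_wpM2l//.
by rewrite -raddfMn lecE/= eqxx/= -mulr_natl; have := hn0 (n0 + k)%N (leq_addr _ _); lra.
Qed.

(** * Theta series as unconditional sums *)

(** The maps n and -n-1 from [nat] partition [int], and both one-sided series converge, so the two
    total limits in [bilateral_sum] are genuine. *)
Lemma bilateral_sumE (R : realType) (u : int -> R[i]) (s : R[i]) :
  abs_summable u -> has_sum u s -> bilateral_sum u = s.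
Proof.
move=> us uS; rewrite /bilateral_sum.
have i1 : injective Posz by move=> x y [].
have i2 : injective (fun n : nat => - n.+1%:Z) by move=> x y; lia.
have [s1 us1] := abs_summable_has_sum (abs_summable_comp i1 us).
have [s2 us2] := abs_summable_has_sum (abs_summable_comp i2 us).
have /= l1 := @cvg_lim _ (@norm_hausdorff _ (R[i] : numFieldType)^o)
  _ _ _ _ _ (has_sum_series us1).
have /= l2 := @cvg_lim _ (@norm_hausdorff _ (R[i] : numFieldType)^o)
  _ _ _ _ _ (has_sum_series us2).
rewrite [X in X + _]l1 [X in _ + X]l2; apply/esym.
apply: (has_sum_split i1 i2 _ _ uS us1 us2); first by move=> x y; lia.
case=> n; [by left; exists n|right; exists n; lia].
Qed.

(* The terms of theta a b when a * b = P ^+ 2: taking a square root of a * b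
   clears the halves in the exponents. *)
Definition qterm (K : numFieldType) (a P : K) (n : int) : K :=
  a ^ n * P ^ (n * n - n).

Lemma qtermS (K : numFieldType) (a P : K) (n : int) : a != 0 -> P != 0 ->
  qterm a P (n + 1) = qterm a P n * (a * P ^ (2 * n)).
Proof.
move=> a0 P0; rewrite /qterm.
have -> : (n + 1) * (n + 1) - (n + 1) = (n * n - n) + 2 * n by ring.
by rewrite !expfzDr// expr1z mulrACA.
Qed.

Lemma qtermB1 (K : numFieldType) (a P : K) (n : int) : a != 0 -> P != 0 ->
  qterm a P (n - 1) = qterm a P n * (a^-1 * P ^ (2 - 2 * n)).
Proof.
move=> a0 P0; rewrite /qterm.
have -> : (n - 1) * (n - 1) - (n - 1) = (n * n - n) + (2 - 2 * n) by ring.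
by rewrite !expfzDr// exprN1 mulrACA.
Qed.

(** Ratio test in both directions: the ratio of consecutive terms decays like [|P|^(2n)]. *)
Lemma abs_summable_qterm (R : realType) (a P : R[i]) :
  a != 0 -> P != 0 -> `|P| < 1 -> abs_summable (qterm a P).
Proof.
move=> a0 P0.
have nE (z : R[i]) : exists y : R, `|z| = y%:C%C.
  by exists (complex.Re `|z|); rewrite RRe_real// ger0_real.
have [x xE] := nE P; have [y yE] := nE a; have [y' y'E] := nE a^-1.
rewrite xE ltcE/= => x1.
have x0 : 0 <= x by have := normr_ge0 P; rewrite xE lecE => /andP[].
have x2 : 0 <= x ^+ 2 < 1 by rewrite sqr_ge0 expr_lt1//; case/andP: x1.
apply: abs_summable_int.
  apply: (@abs_summable_ratio _ _ y _ x2) => n.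
  have -> : n.+1%:Z = n%:Z + 1 by lia.
  rewrite qtermS//; move: (qterm _ _ _) => z.
  have -> : 2 * n%:Z = (2 * n)%N by lia.
  by rewrite -exprnP 2!normrM normrX yE xE -exprM -rmorphXn -rmorphM.
(* Going down from index -n-1, the ratio is a^(-1) P^(2n+4), hence the factor [x ^+ 4]. *)
apply: (@abs_summable_ratio _ _ (y' * x ^+ 4) _ x2) => n.
have -> : - n.+2%:Z = - n.+1%:Z - 1 by lia.
rewrite qtermB1//; move: (qterm _ _ _) => z.
have -> : 2 - 2 * - n.+1%:Z = (4 + 2 * n)%N by lia.
rewrite -exprnP 2!normrM normrX y'E xE -mulrA -exprM -exprD.
by rewrite -rmorphXn -rmorphM.
Qed.

(** With f = n(n-1)/2 one has n(n+1)/2 = f + n, so the term is a^n (ab)^f = a^n P^(2f). *)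
Lemma theta_termE (K : numFieldType) (a b P : K) (n : int) :
  a != 0 -> b != 0 -> a * b = P ^+ 2 ->
  a ^ ((n * (n + 1)) %/ 2)%Z * b ^ ((n * (n - 1)) %/ 2)%Z = qterm a P n.
Proof.
move=> a0 b0 abP.
have [f hf] : exists f : int, n * n - n = f * 2.
  have := divz_eq n 2; set j := (n %/ 2)%Z => hn.
  have : (n %% 2)%Z = 0 \/ (n %% 2)%Z = 1 by lia.
  case=> e; rewrite hn e; [exists (j * (2 * j - 1))|exists (j * (2 * j + 1))]; ring.
have -> : n * (n + 1) = (f + n) * 2 by rewrite mulrDl -hf; ring.
have -> : n * (n - 1) = f * 2 by rewrite -hf; ring.
rewrite !mulzK// expfzDr// /qterm hf mulrAC -expfzMl abP mulrC.
by rewrite [f * 2]mulrC -exprz_exp.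
Qed.

Lemma has_sum_theta (R : realType) (a b P : R[i]) :
  a != 0 -> b != 0 -> `|P| < 1 -> a * b = P ^+ 2 ->
  has_sum (qterm a P) (theta a b).
Proof.
move=> a0 b0 P1 abP.
have P0 : P != 0 by rewrite -sqrf_eq0 -abP mulf_neq0.
have us := abs_summable_qterm a0 P0 P1.
have [s hs] := abs_summable_has_sum us.
suff -> : theta a b = s by [].
rewrite -(bilateral_sumE us hs) /theta; congr bilateral_sum.
by apply/funext => n; exact: theta_termE.
Qed.

Lemma has_sum_prod (R : realType) (I J : choiceType) (u : I -> R[i])
    (v : J -> R[i]) (s t : R[i]) :
  abs_summable u -> abs_summable v -> has_sum u s -> has_sum v t ->
  has_sum (fun p => u p.1 * v p.2) (s * t).
Proof.
move=> us vs uS vT.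
have [r hr] := abs_summable_has_sum (abs_summable_mul us vs).
by rewrite -(has_sum_mul hr uS vT).
Qed.

Lemma theta_qterm (R : realType) (a b P : R[i]) :
  a != 0 -> b != 0 -> `|P| < 1 -> a * b = P ^+ 2 ->
  abs_summable (qterm a P) /\ has_sum (qterm a P) (theta a b).
Proof.
move=> a0 b0 P1 abP; split; last exact: has_sum_theta.
by apply: abs_summable_qterm => //; rewrite -sqrf_eq0 -abP mulf_neq0.
Qed.

(** * Termwise identities between products of two theta terms *)

Section QtermIdentities.
Variables (K : numFieldType) (Q y : K).
Hypotheses (Q0 : Q != 0) (y0 : y != 0).

Let yV0 : y^-1 != 0. Proof. by rewrite invr_eq0. Qed.

(** Normal form collecting all powers of [Q], which turns the identities below into polynomial
    identities between exponents. *)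
Let qtermE (c : K) (k l : nat) (n : int) : c != 0 ->
  qterm (Q ^+ k * c) (Q ^+ l) n = c ^ n * Q ^ (l%:Z * (n * n - n) + k%:Z * n).
Proof.
move=> c0; rewrite /qterm expfzMl [Q ^+ k ^ n * _]mulrC -mulrA; congr (_ * _).
by rewrite (exprnP Q k) (exprnP Q l) !exprz_exp -expfzDr// addrC.
Qed.

Let sgD (sg : K) (a b c : int) : sg ^+ 2 = 1 -> a + b = 2 * c ->
  sg ^ a * sg ^ b = 1.
Proof.
move=> sg2 abc; have sg0 : sg != 0 by rewrite -sqrf_eq0 sg2 oner_eq0.
by rewrite -expfzDr// abc -exprz_exp -exprnP sg2 exp1rz.
Qed.

(** The exponents agree by (m-n)^2 + (m+n)^2 = 2m^2 + 2n^2; the signs cancel since the two indices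
    add up to 2m. *)
Lemma qterm_sqr_even (sg : K) (m n : int) : sg ^+ 2 = 1 ->
  qterm (Q * y) (Q ^+ 2) m * qterm (Q * y) (Q ^+ 2) n =
  qterm (sg * Q) Q (m - n) * qterm (sg * y) Q (m + n).
Proof.
move=> sg2; have sg0 : sg != 0 by rewrite -sqrf_eq0 sg2 oner_eq0.
rewrite !(qtermE 1 2 _ y0) (mulrC sg Q) (qtermE 1 1 _ sg0).
rewrite -[sg * y]mul1r (qtermE 0 1 _ (mulf_neq0 sg0 y0)) expfzMl.
rewrite [RHS](_ : _ = (sg ^ (m - n) * sg ^ (m + n)) * (y ^ (m + n) *
  (Q ^ (1%:Z * ((m - n) * (m - n) - (m - n)) + 1%:Z * (m - n)) *
   Q ^ (1%:Z * ((m + n) * (m + n) - (m + n)) + 0%:Z * (m + n))))); last by ring.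
rewrite (sgD (c := m) sg2); last by ring.
by rewrite mul1r mulrACA -!expfzDr//; congr (_ * _ ^ _); ring.
Qed.

(** With u = m + n, the indices u and 1 - u give the same exponent u^2 - u of [Q]. The two indices
    on the right add up to 1 - 2n, so one factor [sg] survives. *)
Lemma qterm_sqr_odd (sg : K) (m n : int) : sg ^+ 2 = 1 ->
  sg * y * (qterm (Q / y) (Q ^+ 2) m * qterm (Q / y) (Q ^+ 2) n) =
  qterm (sg * Q) Q (m - n) * qterm (sg * y) Q (1 - m - n).
Proof.
move=> sg2; have sg0 : sg != 0 by rewrite -sqrf_eq0 sg2 oner_eq0.
rewrite !(qtermE 1 2 _ yV0) (mulrC sg Q) (qtermE 1 1 _ sg0).
rewrite -[sg * y in RHS]mul1r (qtermE 0 1 _ (mulf_neq0 sg0 y0)) expfzMl.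
set s2 := 1 - m - n.
rewrite [RHS](_ : _ = (sg ^ (m - n) * sg ^ s2) * (y ^ s2 *
  (Q ^ (1%:Z * ((m - n) * (m - n) - (m - n)) + 1%:Z * (m - n)) *
   Q ^ (1%:Z * (s2 * s2 - s2) + 0%:Z * s2)))); last by ring.
have -> : sg ^ (m - n) * sg ^ s2 = sg.
  have -> : s2 = 1%:Z + (s2 - 1) by ring.
  rewrite (expfzDr 1%:Z (s2 - 1) sg0) expr1z mulrCA (@sgD _ _ _ (- n))// ?mulr1//.
  by rewrite /s2; ring.
rewrite -!mulrA; congr (_ * _).
rewrite [LHS](_ : _ = (y ^ 1%:Z * (y^-1 ^ m * y^-1 ^ n)) *
  (Q ^ (2%:Z * (m * m - m) + 1%:Z * m) * Q ^ (2%:Z * (n * n - n) + 1%:Z * n)));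
  last by rewrite expr1z; ring.
by rewrite !exprz_inv -!expfzDr// /s2; congr (_ ^ _ * _ ^ _); ring.
Qed.

(** The substitution separates the variables: the product is y^(-2l) Q^(4j^2 - 2j + (2l)^2). *)
Lemma qterm_mul_even (j l : int) :
  qterm (Q * y) (Q ^+ 2) (j - l) * qterm (Q / y) (Q ^+ 2) (j + l) =
  qterm (Q ^+ 2) (Q ^+ 4) j * qterm (Q / y) Q (2 * l).
Proof.
rewrite (qtermE 1 2 _ y0) (qtermE 1 2 _ yV0) (qtermE 1 1 _ yV0).
rewrite -[Q ^+ 2 in RHS]mulr1 (qtermE 2 4 _ (oner_neq0 _)) exp1rz mul1r.
rewrite mulrACA [RHS]mulrCA !exprz_inv -!expfzDr//.
by congr (_ ^ _ * _ ^ _); ring.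
Qed.

(** Same separation for indices of odd sum: y^(-2l-1) Q^(4j^2 - 2j + (2l+1)^2). *)
Lemma qterm_mul_odd (j l : int) :
  qterm (Q * y) (Q ^+ 2) (- j - l) * qterm (Q / y) (Q ^+ 2) (1 - j + l) =
  qterm (Q ^+ 2) (Q ^+ 4) j * qterm (Q / y) Q (2 * l + 1).
Proof.
rewrite (qtermE 1 2 _ y0) (qtermE 1 2 _ yV0) (qtermE 1 1 _ yV0).
rewrite -[Q ^+ 2 in RHS]mulr1 (qtermE 2 4 _ (oner_neq0 _)) exp1rz mul1r.
rewrite mulrACA [RHS]mulrCA !exprz_inv -!expfzDr//.
by congr (_ ^ _ * _ ^ _); ring.
Qed.
End QtermIdentities.

(** * The two identities between theta functions *)

Section ThetaIdentities.
Variables (R : realType) (Q y : R[i]).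
Hypotheses (Q0 : Q != 0) (y0 : y != 0) (Q1 : `|Q| < 1).

Let Qn1 n : `|Q ^+ n.+1| < 1.
Proof. by rewrite normrX exprn_ilt1. Qed.

Lemma theta_sqr_add (sg : R[i]) : sg ^+ 2 = 1 ->
  theta (Q * y) (Q ^+ 3 / y) * theta (Q * y) (Q ^+ 3 / y) +
  sg * y * (theta (Q / y) (Q ^+ 3 * y) * theta (Q / y) (Q ^+ 3 * y)) =
  theta (sg * Q) (sg * Q) * theta (sg * y) (sg * (Q ^+ 2 / y)).
Proof.
move=> sg2.
have sg0 : sg != 0 by rewrite -sqrf_eq0 sg2 oner_eq0.
have yV0 : y^-1 != 0 by rewrite invr_eq0.
have [Ds DS] : abs_summable (qterm (Q * y) (Q ^+ 2)) /\
    has_sum (qterm (Q * y) (Q ^+ 2)) (theta (Q * y) (Q ^+ 3 / y)).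
  by apply: theta_qterm; rewrite ?mulf_neq0 ?expf_neq0// ?Qn1//; field.
have [Ns NS] : abs_summable (qterm (Q / y) (Q ^+ 2)) /\
    has_sum (qterm (Q / y) (Q ^+ 2)) (theta (Q / y) (Q ^+ 3 * y)).
  by apply: theta_qterm; rewrite ?mulf_neq0 ?expf_neq0// ?Qn1//; field.
have [Ps PS] : abs_summable (qterm (sg * Q) Q) /\
    has_sum (qterm (sg * Q) Q) (theta (sg * Q) (sg * Q)).
  by apply: theta_qterm; rewrite ?mulf_neq0// mulrACA -expr2 sg2 mul1r.
have [Fs FS] : abs_summable (qterm (sg * y) Q) /\
    has_sum (qterm (sg * y) Q) (theta (sg * y) (sg * (Q ^+ 2 / y))).
  apply: theta_qterm; rewrite ?mulf_neq0 ?expf_neq0//.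
  by rewrite mulrACA -expr2 sg2 mul1r; field.
have PFS := has_sum_prod Ps Fs PS FS.
have DDS := has_sum_prod Ds Ds DS DS.
have NNS := has_sumZ (c := sg * y) (has_sum_prod Ns Ns NS NS).
(* [h1] and [h2] parametrize the pairs of even and of odd sum. *)
pose h1 (p : int * int) := (p.1 - p.2, p.1 + p.2).
pose h2 (p : int * int) := (p.1 - p.2, 1 - p.1 - p.2).
move: DDS NNS; set D := theta (Q * y) _; set N := theta (Q / y) _ => DDS NNS.
pose u (p : int * int) := qterm (sg * Q) Q p.1 * qterm (sg * y) Q p.2.
have hD : has_sum (u \o h1) (D * D).
  by apply: has_sum_eq DDS => -[m n]; exact: qterm_sqr_even.
have hN : has_sum (u \o h2) (sg * y * (N * N)).
  by apply: has_sum_eq NNS => -[m n]; exact: qterm_sqr_odd.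
have h1I : injective h1 by move=> [m n] [m' n'] [e1 e2]; congr pair; lia.
have h2I : injective h2 by move=> [m n] [m' n'] [e1 e2]; congr pair; lia.
apply/esym; apply: (has_sum_split h1I h2I _ _ PFS hD hN).
  by move=> [m n] [m' n'] [e1 e2]; lia.
move=> [r s]; have := divz_eq (r + s) 2; set j := ((r + s) %/ 2)%Z.
have : ((r + s) %% 2)%Z = 0 \/ ((r + s) %% 2)%Z = 1 by lia.
(* The witnesses solve m - n = r together with m + n = s when r + s = 2j, or with 1 - m - n = s when
   r + s = 2j + 1. *)
case=> -> rs; [left; exists (j, j - r)|right; exists (j + 1 - s, j + 1 - s - r)].
  by rewrite /h1/=; congr pair; lia.
by rewrite /h2/=; congr pair; lia.
Qed.

(** Both double series are cut into the same two subseries: the left one by the parity of the sum of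
    the indices, the right one by the parity of the second index. *)
Lemma theta_mul :
  theta (Q * y) (Q ^+ 3 / y) * theta (Q / y) (Q ^+ 3 * y) =
  psi (Q ^+ 2) * theta (Q / y) (Q * y).
Proof.
have yV0 : y^-1 != 0 by rewrite invr_eq0.
have [Ds DS] : abs_summable (qterm (Q * y) (Q ^+ 2)) /\
    has_sum (qterm (Q * y) (Q ^+ 2)) (theta (Q * y) (Q ^+ 3 / y)).
  by apply: theta_qterm; rewrite ?mulf_neq0 ?expf_neq0// ?Qn1//; field.
have [Ns NS] : abs_summable (qterm (Q / y) (Q ^+ 2)) /\
    has_sum (qterm (Q / y) (Q ^+ 2)) (theta (Q / y) (Q ^+ 3 * y)).
  by apply: theta_qterm; rewrite ?mulf_neq0 ?expf_neq0// ?Qn1//; field.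
have [Ps PS] : abs_summable (qterm (Q ^+ 2) (Q ^+ 4)) /\
    has_sum (qterm (Q ^+ 2) (Q ^+ 4)) (psi (Q ^+ 2)).
  by apply: theta_qterm; rewrite ?mulf_neq0 ?expf_neq0// ?Qn1//; ring.
have [Fs FS] : abs_summable (qterm (Q / y) Q) /\
    has_sum (qterm (Q / y) Q) (theta (Q / y) (Q * y)).
  by apply: theta_qterm; rewrite ?mulf_neq0//; field.
have DNs := abs_summable_mul Ds Ns.
have DNS := has_sum_prod Ds Ns DS NS.
have PFS := has_sum_prod Ps Fs PS FS.
pose h1 (p : int * int) := (p.1 - p.2, p.1 + p.2).
pose h2 (p : int * int) := (- p.1 - p.2, 1 - p.1 + p.2).
pose k1 (p : int * int) := (p.1, 2 * p.2).
pose k2 (p : int * int) := (p.1, 2 * p.2 + 1).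
have h1I : injective h1 by move=> [m n] [m' n'] [e1 e2]; congr pair; lia.
have h2I : injective h2 by move=> [m n] [m' n'] [e1 e2]; congr pair; lia.
have k1I : injective k1 by move=> [m n] [m' n'] [e1 e2]; congr pair; lia.
have k2I : injective k2 by move=> [m n] [m' n'] [e1 e2]; congr pair; lia.
(* Only the existence of the subsums [s1] and [s2] matters; their values are never computed. *)
have [s1 hs1] := abs_summable_has_sum (abs_summable_comp h1I DNs).
have [s2 hs2] := abs_summable_has_sum (abs_summable_comp h2I DNs).
pose w (p : int * int) := qterm (Q ^+ 2) (Q ^+ 4) p.1 * qterm (Q / y) Q p.2.
have ks1 : has_sum (w \o k1) s1.
  by apply: has_sum_eq hs1 => -[j l]; exact: qterm_mul_even.
have ks2 : has_sum (w \o k2) s2.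
  by apply: has_sum_eq hs2 => -[j l]; exact: qterm_mul_odd.
transitivity (s1 + s2).
  apply: (has_sum_split h1I h2I _ _ DNS hs1 hs2).
    by move=> [m n] [m' n'] [e1 e2]; lia.
  move=> [r s]; have := divz_eq (r + s) 2; set j := ((r + s) %/ 2)%Z.
  have : ((r + s) %% 2)%Z = 0 \/ ((r + s) %% 2)%Z = 1 by lia.
  case=> -> rs; [left; exists (j, j - r)|right; exists (- j, j - r)].
    by rewrite /h1/=; congr pair; lia.
  by rewrite /h2/=; congr pair; lia.
apply/esym; apply: (has_sum_split k1I k2I _ _ PFS ks1 ks2).
  by move=> [m n] [m' n'] [e1 e2]; lia.
move=> [r s]; have := divz_eq s 2; set j := (s %/ 2)%Z.
have : (s %% 2)%Z = 0 \/ (s %% 2)%Z = 1 by lia.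
by case=> -> rs; [left|right]; exists (r, j); rewrite /k1/k2/=; congr pair; lia.
Qed.

End ThetaIdentities.

(** * The finite form of the triple product *)

Section FiniteTripleProduct.
Variable K : numFieldType.
Implicit Types a b p P : K.

Definition qpoch_part a p (n : nat) : K := \prod_(0 <= i < n) (1 - a * p ^+ i).

(* 1 / (p; p)_j, set to 0 for j < 0 so that the recurrence [qfact_inv_pred]
   holds at every integer and the finite sums below become sums over int. *)
Definition qfact_inv p (j : int) : K :=
  if j is Posz n then (qpoch_part p p n)^-1 else 0.

Lemma qpoch_partS a p n :
  qpoch_part a p n.+1 = qpoch_part a p n * (1 - a * p ^+ n).
Proof. by rewrite /qpoch_part big_nat_recr. Qed.

(** At j = 0 the factor 1 - p^0 vanishes, in agreement with the value 0 at -1. *)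
Lemma qfact_inv_pred p (j : int) : (forall n, p ^+ n.+1 != 1) ->
  qfact_inv p (j - 1) = (1 - p ^ j) * qfact_inv p j.
Proof.
move=> p1; case: j => [[|n]|n]; last 1 first.
- by rewrite NegzE (_ : - n.+1%:Z - 1 = Negz n.+1) /= ?mulr0// NegzE; lia.
- by rewrite /= expr0z subrr mul0r.
rewrite (_ : n.+1%:Z - 1 = n); last by lia.
rewrite /= qpoch_partS -exprS -exprnP invfM mulrCA mulfV ?mulr1//.
by rewrite subr_eq0 eq_sym.
Qed.

(** Induction on [N]. Since ab = p, the new factor (1 + a p^N)(1 + b p^N) equals 1 + p^(2N+1) + a
    p^N + b p^N; the last two summands are matched with shifts of the index by -1 and +1. *)
Lemma finite_triple_product a b P (N : nat) : a != 0 -> b != 0 ->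
  a * b = P ^+ 2 -> (forall n, (P ^+ 2) ^+ n.+1 != 1) ->
  has_sum (fun n : int => qfact_inv (P ^+ 2) (N%:Z + n) *
                          qfact_inv (P ^+ 2) (N%:Z - n) * qterm a P n)
    (qpoch_part (- a) (P ^+ 2) N * qpoch_part (- b) (P ^+ 2) N *
     qfact_inv (P ^+ 2) (2 * N)%N).
Proof.
move=> a0 b0 abP p1; set p := P ^+ 2.
have p0 : p != 0 by rewrite /p -abP mulf_neq0.
have P0 : P != 0 by rewrite -sqrf_eq0.
elim: N => [|N IHN].
  set u := (fun n : int => _).
  have -> : qpoch_part (- a) p 0 * qpoch_part (- b) p 0 * qfact_inv p (2 * 0)%N =
      u 0.
    rewrite /u/qterm /= /qpoch_part !big_nil !expr0z.
    by rewrite invr1 !mulr1.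
  (* For N = 0 only n = 0 contributes: otherwise n or -n is negative and [qfact_inv] is 0 there. *)
  apply: has_sum_supp1 => -[[|n]|n]// _; rewrite /u.
    by rewrite sub0r -NegzE /= mulr0 mul0r.
  by rewrite add0r /= !mul0r.
set r := qfact_inv p; set u := (fun n : int => _) in IHN.
set S := (X in has_sum _ X) in IHN.
(* [k] is the ratio of 1/(p;p)_(2N+2) to 1/(p;p)_(2N). *)
pose k := ((1 - p ^+ (2 * N).+1) * (1 - p ^+ (2 * N).+2))^-1.
have k1 : 1 - p ^+ (2 * N).+1 != 0 by rewrite subr_eq0 eq_sym.
have k2 : 1 - p ^+ (2 * N).+2 != 0 by rewrite subr_eq0 eq_sym.
have bp : bijective (fun n : int => n - 1).
  by exists (fun n => n + 1) => n; [exact: subrK|exact: addrK].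
have bs : bijective (fun n : int => n + 1).
  by exists (fun n => n - 1) => n; [exact: addrK|exact: subrK].
have := has_sumZ (c := k) (has_sumD (has_sumD (has_sumZ (c := 1 + p ^+ (2 * N).+1) IHN)
  (has_sumZ (c := a * p ^+ N) (has_sum_reindex bp IHN)))
  (has_sumZ (c := b * p ^+ N) (has_sum_reindex bs IHN))).
have -> : k * ((1 + p ^+ (2 * N).+1) * S + a * p ^+ N * S + b * p ^+ N * S) =
    qpoch_part (- a) p N.+1 * qpoch_part (- b) p N.+1 * r (2 * N.+1)%N.
  rewrite !qpoch_partS /S -/r.
  have -> : r (2 * N)%N = (1 - p ^+ (2 * N).+1) * (1 - p ^+ (2 * N).+2) * r (2 * N.+1)%N.
    have -> : (2 * N)%N = (2 * N.+1)%N%:Z - 1 - 1 :> int by lia.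
    rewrite /r !qfact_inv_pred// (_ : (2 * N.+1)%N%:Z - 1 = (2 * N).+1); last by lia.
    by rewrite (_ : (2 * N.+1)%N = (2 * N).+2) ?mulrA//; lia.
  have pN : p ^+ (2 * N).+1 = a * b * p ^+ N * p ^+ N.
    by rewrite abP -/p -exprS -exprD; congr (_ ^+ _); lia.
  rewrite /k; move: k1 k2; rewrite pN; move: (p ^+ N) (p ^+ (2 * N).+2) => y z k1 k2.
  by field; rewrite k1 k2.
apply: has_sum_eq => n; rewrite /u/=.
rewrite qtermS// qtermB1//; set t := qterm a P n.
(* All three contributions are written as multiples of [r A * r B * t], the summand for N + 1. *)
set A := N.+1%:Z + n; set B := N.+1%:Z - n.
have e1 : N%:Z + n = A - 1 by rewrite /A; lia.
have e2 : N%:Z - n = B - 1 by rewrite /B; lia.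
have e3 : N%:Z + (n - 1) = A - 1 - 1 by rewrite /A; lia.
have e4 : N%:Z - (n - 1) = B by rewrite /B; lia.
have e5 : N%:Z + (n + 1) = A by rewrite /A; lia.
have e6 : N%:Z - (n + 1) = B - 1 - 1 by rewrite /B; lia.
rewrite e1 e2 e3 e4 e5 e6 -/r /r !qfact_inv_pred// -/r !(expfzDr _ (-1))// exprN1.
have pP (j : int) : p ^ j = P ^ (2 * j) by rewrite /p (exprnP P 2) exprz_exp.
have ep : P ^ (2 - 2 * n) * p ^+ N = p ^ B.
  by rewrite (exprnP p N) !pP -expfzDr// /B; congr (_ ^ _); lia.
have es : b * p ^+ N * (a * P ^ (2 * n)) = p ^ A.
  rewrite mulrACA [b * a]mulrC abP -/p.
  rewrite (exprnP p N) -pP -{1}(expr1z p) -!expfzDr// /A; congr (_ ^ _); lia.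
have ea : a * p ^+ N * (a^-1 * P ^ (2 - 2 * n)) = p ^ B by rewrite -ep; field.
have pAB : p ^+ (2 * N).+2 = p ^ A * p ^ B.
  by rewrite -expfzDr// exprnP /A/B; congr (_ ^ _); lia.
have pAB1 : p ^+ (2 * N).+1 = p ^ A * p ^ B / p.
  by rewrite -pAB [X in _ = X / p]exprSr mulfK.
move: k1 k2; rewrite /k pAB pAB1 => k1 k2.
rewrite [LHS](_ : _ = ((1 - p ^ A * p ^ B / p) * (1 - p ^ A * p ^ B))^-1 *
  ((1 + p ^ A * p ^ B / p) * ((1 - p ^ A) * (1 - p ^ B)) +
   (a * p ^+ N * (a^-1 * P ^ (2 - 2 * n))) * ((1 - p ^ A / p) * (1 - p ^ A)) +
   (b * p ^+ N * (a * P ^ (2 * n))) * ((1 - p ^ B / p) * (1 - p ^ B))) *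
  (r A * r B * t)); last by ring.
rewrite ea es; move: (p ^ A) (p ^ B) k1 k2 => X Y k1 k2.
have k3 : p - X * Y != 0.
  have -> : p - X * Y = p * (1 - X * Y / p) by field.
  exact: mulf_neq0.
(* What remains is (1 + XY/p)(1-X)(1-Y) + Y(1-X/p)(1-X) + X(1-Y/p)(1-Y) = (1 - XY/p)(1 - XY). *)
rewrite [X in X * _](_ : _ = 1) ?mul1r//.
by field; rewrite p0 k2 k3.
Qed.
End FiniteTripleProduct.

(** * Convergence of infinite products and auxiliary limits *)

Lemma has_sum_telescope (K : numFieldType) (f : nat -> K) (s : K) :
  has_sum (fun n => f n.+1 - f n) s -> (f @ \oo --> s + f 0%N)%classic.
Proof.
move=> fs.
have h : (series (fun n => f n.+1 - f n) n + f 0%N @[n --> \oo] -->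
    s + f 0%N)%classic.
  by apply: cvgD; [exact: has_sum_series|exact: cvg_cst].
have e : (fun n => series (fun n => f n.+1 - f n) n + f 0%N) = f.
  by apply/funext => n; rewrite /series/= telescope_sumr// subrK.
by rewrite e in h.
Qed.

(** The partial products are bounded, so their consecutive differences [f n * (g n - 1)] are
    absolutely summable and telescope to the limit. *)
Lemma prod_cvg (R : realType) (g : nat -> R[i]) (c x : R) :
  0 <= x < 1 -> (forall n, `|g n - 1| <= (c * x ^+ n)%:C%C) ->
  exists B l : R[i], (forall n, `|\prod_(0 <= i < n) g i| <= B) /\
    (\prod_(0 <= i < n) g i @[n --> \oo] --> (l : (R[i] : numFieldType)))%classic.
Proof.
move=> /andP[x0 x1] gc; set f := (fun n => \prod_(0 <= i < n) g i).
have c0 : 0 <= c.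
  by have := le_trans (normr_ge0 _) (gc 0%N); rewrite expr0 mulr1 lecE => /andP[].
have geo n : \sum_(0 <= i < n) x ^+ i <= (1 - x)^-1.
  have e : (1 - x) * \sum_(0 <= i < n) x ^+ i = 1 - x ^+ n.
    by rewrite big_mkord -opprB mulNr -subrX1 opprB.
  rewrite -[leRHS]mul1r ler_pdivlMr ?subr_gt0// mulrC e.
  by rewrite gerBl exprn_ge0.
(* From 1 + t <= exp t and the geometric sum bound 1/(1-x). *)
pose B := expR (c / (1 - x)).
have fB n : `|f n| <= B%:C%C.
  apply: (@le_trans _ _ (expR (c * \sum_(0 <= i < n) x ^+ i))%:C%C); last first.
    by rewrite lecE/= eqxx/= ler_expR ler_wpM2l.
  rewrite /f; elim: n => [|n IHn].
    by rewrite !big_nil mulr0 expR0 normr1.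
  rewrite !big_nat_recr//= normrM mulrDr expRD rmorphM/= ler_pM//.
  rewrite -[g n](subrK 1); apply: (le_trans (ler_normD _ _)); rewrite normr1.
  apply: (le_trans (lerD (gc n) (lexx _))).
  by rewrite -(rmorph1 (real_complex R)) -rmorphD lecE/= eqxx/= addrC expR_ge1Dx.
have [s fs] : exists s, has_sum (fun n => f n.+1 - f n) s.
  apply: abs_summable_has_sum.
  apply: (@abs_summable_nat _ _ (B * (c * (1 - x)^-1))%:C%C) => n.
  apply: (@le_trans _ _ (B * (c * \sum_(0 <= i < n) x ^+ i))%:C%C); last first.
    by rewrite lecE/= eqxx/= ler_wpM2l ?expR_ge0// ler_wpM2l.
  rewrite !mulr_sumr rmorph_sum; apply: ler_sum => i _.
  rewrite /f big_nat_recr//= -[X in _ - X]mulr1 -mulrBr normrM rmorphM/=.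
  by apply: ler_pM => //; exact: fB.
exists B%:C%C, (s + f 0%N); split; first exact: fB.
exact: has_sum_telescope.
Qed.

Lemma expr_neq1 (K : numDomainType) (p : K) (n : nat) :
  `|p| < 1 -> p ^+ n.+1 != 1.
Proof.
move=> p1; apply/negP => /eqP/(congr1 Num.norm).
rewrite normrX normr1 => e.
by have := exprn_ilt1 n.+1 (normr_ge0 p) p1; rewrite e ltxx.
Qed.

Lemma cvg_int_shift (K : numFieldType) (f : int -> K) (l : K) (k : int) :
  (f n%:Z @[n --> \oo] --> l -> f (n%:Z + k) @[n --> \oo] --> l)%classic.
Proof.
move=> fl; rewrite -(cvg_shiftn `|k|%N).
have [j jE] : exists j : nat, `|k|%N%:Z + k = j.
  by exists `|(`|k|%N%:Z + k)%R|%N; lia.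
have -> : (fun n => f ((n + `|k|)%N%:Z + k)) = (fun n => f (n + j)%N%:Z).
  by apply/funext => n; congr f; lia.
by rewrite (cvg_shiftn j (fun n => f n%:Z)).
Qed.

Lemma cvg_double (K : numFieldType) (f : nat -> K) (l : K) :
  (f @ \oo --> l -> f (2 * n)%N @[n --> \oo] --> l)%classic.
Proof.
move=> fl; apply: (cvg_comp (fun n => 2 * n)%N f _ fl) => P [N _ NP].
by exists N => // n /= Nn; apply: NP => /=; lia.
Qed.

Lemma lim_triple_unique (K : numFieldType) (u v r : nat -> K) (a b l s : K) :
  (u @ \oo --> a -> v @ \oo --> b -> r @ \oo --> l ->
   (fun n => u n * v n * r (2 * n)%N) @ \oo --> s -> s = a * b * l)%classic.
Proof.
move=> ua vb rl h.
apply: (cvg_unique (@norm_hausdorff _ K^o) h).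
by apply: cvgM; [exact: cvgM|exact: cvg_double].
Qed.

Lemma lim_mul_eq1 (K : numFieldType) (u v : nat -> K) (a b : K) :
  (u @ \oo --> a -> v @ \oo --> b -> (forall n, u n * v n = 1) ->
   a * b = 1)%classic.
Proof.
move=> ua vb uv.
have h : ((fun n => u n * v n) @ \oo --> a * b)%classic by exact: cvgM.
have e : (fun n => u n * v n) = fun=> 1 by apply/funext => n; exact: uv.
rewrite e in h; apply: (cvg_unique (@norm_hausdorff _ K^o) h).
exact: cvg_cst.
Qed.

Lemma cvg_qterm_coef (K : numFieldType) (f : int -> K) (l t : K) (k : int) :
  (f n%:Z @[n --> \oo] --> l ->
   f (n%:Z + k) * f (n%:Z - k) * t @[n --> \oo] --> l * l * t)%classic.
Proof.
move=> fl; apply: cvgMl; apply: cvgM; exact: cvg_int_shift.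
Qed.

(** Here [q] stands for (p;p)_oo and [l] for its inverse, which occurs squared on the series side of
    the limit and once on the product side. *)
Lemma eq_mul_inv_sqr (K : comPzRingType) (a b l q t : K) :
  l * q = 1 -> l * l * t = a * b * l -> t = a * b * q.
Proof.
move=> lq e; rewrite -[LHS]mul1r -[LHS]mul1r -{1}lq -lq.
rewrite [LHS](_ : _ = q * q * (l * l * t)); last by ring.
rewrite e [LHS](_ : _ = a * b * q * (l * q)); last by ring.
by rewrite lq mulr1.
Qed.

(** * Jacobi's triple product identity *)

Section JacobiTripleProduct.
Variable R : realType.
Local Notation C := (R[i] : numFieldType).

Lemma norm_lt1P (p : R[i]) : `|p| < 1 ->
  exists2 x : R, 0 <= x < 1 & `|p| = x%:C%C.
Proof.
move=> p1; have pE : `|p| = (complex.Re `|p|)%:C%C.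
  by rewrite RRe_real// ger0_real.
exists (complex.Re `|p|) => //; have := normr_ge0 p.
by move: p1; rewrite pE ltcE lecE/= => /andP[_ ->] /andP[_ ->].
Qed.

Lemma qpoch_cvg (a p : R[i]) : `|p| < 1 ->
  (qpoch_part a p @ \oo --> (qpoch a p : C))%classic.
Proof.
move=> /norm_lt1P[x x1 xE].
have [y yE] : exists y : R, `|a| = y%:C%C.
  by exists (complex.Re `|a|); rewrite RRe_real// ger0_real.
have [|B [l [_ hl]]] := @prod_cvg R (fun i => 1 - a * p ^+ i) y x x1.
  by move=> n; rewrite addrC addKr normrN normrM normrX xE yE rmorphM rmorphXn.
have e := @cvg_lim C^o (@norm_hausdorff _ C^o) _ _ _ _ l hl.
by rewrite /qpoch [X in (_ --> X)%classic]e.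
Qed.

(** The reciprocals of the factors form a convergent product themselves. This gives the uniform
    bound for domination and shows that (p;p)_oo is invertible. *)
Lemma qfact_inv_cvg (p : R[i]) : `|p| < 1 -> exists B l : R[i],
  [/\ forall j, `|qfact_inv p j| <= B,
      (qfact_inv p n%:Z @[n --> \oo] --> (l : C))%classic &
      l * qpoch p p = 1].
Proof.
move=> p1; have [x x1 xE] := norm_lt1P p1.
have [x0 xlt] := andP x1.
have pn n : 1 - p * p ^+ n != 0.
  by rewrite subr_eq0 eq_sym -exprS expr_neq1.
(* The constant x/(1-x) comes from [|1 - p^(n+1)| >= 1 - x]. *)
have [|B [l [hB hl]]] := @prod_cvg R (fun i => (1 - p * p ^+ i)^-1) (x / (1 - x)) x x1.
  move=> n; have -> : (1 - p * p ^+ n)^-1 - 1 = p * p ^+ n / (1 - p * p ^+ n).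
    by field.
  rewrite normf_div normrM normrX xE.
  have h : (1 - x)%:C%C <= `|1 - p * p ^+ n|.
    rewrite rmorphB/=; apply: le_trans (lerB_dist _ _); rewrite normr1 lerD2l lerN2.
    rewrite normrM normrX xE -rmorphXn -rmorphM lecE/= eqxx/=.
    by rewrite ler_piMr// exprn_ile1// ltW.
  rewrite ler_pdivrMr ?normr_gt0// -rmorphXn -rmorphM.
  apply: le_trans (ler_wpM2l _ h); last first.
    by rewrite lecE/= eqxx/= mulr_ge0 ?exprn_ge0// divr_ge0// subr_ge0 ltW.
  rewrite -rmorphM le_eqVlt; apply/orP; left; apply/eqP; congr (_%:C)%C.
  by field; rewrite subr_eq0 eq_sym lt_eqF.
have e n : \prod_(0 <= i < n) (1 - p * p ^+ i)^-1 = qfact_inv p n.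
  by rewrite /qfact_inv /qpoch_part prodfV.
have hl' : (qfact_inv p n%:Z @[n --> \oo] --> (l : C))%classic.
  by move: hl; under eq_fun do rewrite e.
exists B, l; split => //.
  case=> n; first by rewrite -e; exact: hB.
  by rewrite /= normr0; apply: le_trans (hB 0%N); exact: normr_ge0.
apply: (lim_mul_eq1 (K := C) hl' (qpoch_cvg (a := p) p1)) => n.
by rewrite /= mulVf// prodf_seq_neq0; apply/allP => i _; exact: pn.
Qed.

Lemma jacobi_triple_product (a b : R[i]) :
  a != 0 -> b != 0 -> `|a * b| < 1 ->
  theta a b = qpoch (- a) (a * b) * qpoch (- b) (a * b) * qpoch (a * b) (a * b).
Proof.
move=> a0 b0 ab1.
pose P := sqrtC (a * b); have abP : a * b = P ^+ 2 by rewrite sqrtCK.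
have P1 : `|P| < 1 by move: ab1; rewrite abP normrX expr_lt1.
have [ts tS] := theta_qterm a0 b0 P1 abP.
rewrite abP in ab1 *.
have [B [l [rB rl lq]]] := qfact_inv_cvg ab1.
have p1 n := expr_neq1 n ab1.
have H n := finite_triple_product (N := n) a0 b0 abP p1.
have lts := has_sumZ (c := l * l) tS.
have B0 : 0 <= B by apply: le_trans (rB 0); exact: normr_ge0.
(* The coefficients are bounded by B^2 and their limit is l^2, so this sum dominates both. *)
have B2 : 0 <= B * B + `|l * l| by rewrite addr_ge0// mulr_ge0.
have gs : abs_summable (fun n => (B * B + `|l * l|) * qterm a P n).
  have [M hM] := ts; exists ((B * B + `|l * l|) * M) => A.
  under eq_bigr do rewrite normrM (ger0_norm B2).
  by rewrite -mulr_sumr ler_wpM2l.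
have H1 n (j : int) : `|qfact_inv (P ^+ 2) (n%:Z + j) *
    qfact_inv (P ^+ 2) (n%:Z - j) * qterm a P j| <=
    `|(B * B + `|l * l|) * qterm a P j|.
  rewrite 2!normrM [leRHS]normrM (ger0_norm B2) ler_wpM2r//.
  apply: (le_trans (ler_pM _ _ (rB _) (rB _))); rewrite ?normr_ge0//.
  by rewrite lerDl normr_ge0.
have H2 (j : int) : `|l * l * qterm a P j| <= `|(B * B + `|l * l|) * qterm a P j|.
  by rewrite normrM [leRHS]normrM (ger0_norm B2) ler_wpM2r// lerDr mulr_ge0.
have S := tannery gs H1 H2 (fun j => cvg_qterm_coef (K := C) (t := _) j rl) H lts.
have := lim_triple_unique (K := C) (qpoch_cvg (a := - a) ab1)
  (qpoch_cvg (a := - b) ab1) rl S.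
exact: eq_mul_inv_sqr.
Qed.
End JacobiTripleProduct.

(** * The quotient [T] and the fractional powers of q *)

Lemma qpoch_neq0 (R : realType) (p : R[i]) : `|p| < 1 -> qpoch p p != 0.
Proof.
move=> /qfact_inv_cvg[B [l [_ _ lq]]].
by apply: contra_eq_neq lq => ->; rewrite mulr0 eq_sym oner_neq0.
Qed.

Lemma theta_qpochs (R : realType) (x y p : R[i]) :
  x != 0 -> y != 0 -> x * y = p -> `|p| < 1 ->
  theta (- x) (- y) = qpochs [:: x; y] p * qpoch p p.
Proof.
move=> x0 y0 xyp p1.
have := @jacobi_triple_product R (- x) (- y).
rewrite (mulrNN x y) xyp (opprK x) (opprK y) !oppr_eq0 => -> //.
by rewrite /qpochs !big_cons big_nil mulr1.
Qed.

Lemma qpow_int (K : numFieldType) (w : K) (s : rat) (r : int) :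
  4 * s = r%:~R -> qpow w s = w ^ r.
Proof. by rewrite /qpow => ->; rewrite intrKfloor. Qed.

Lemma inv_sub_add (K : fieldType) (h z N D f1 f2 c G : K) :
  h != 0 -> N != 0 -> D != 0 -> h ^+ 2 = z ->
  D * D + - z * (N * N) = f1 -> D * D + z * (N * N) = f2 -> D * N = c * G ->
  1 / (h * (N / D)) - h * (N / D) = f1 / (h * c * G) /\
  1 / (h * (N / D)) + h * (N / D) = f2 / (h * c * G).
Proof.
move=> h0 N0 D0 <- <- <- e; rewrite -[h * c * G]mulrA -e.
by split; field; rewrite ?h0 ?N0 ?D0.
Qed.

(** The theta identities are taken at y = -z, with sign 1 for the difference and sign -1 for the
    sum. *)
Lemma theta_quotient (R : realType) (Q z h : R[i]) :
  Q != 0 -> z != 0 -> `|Q| < 1 -> h ^+ 2 = z ->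
  let N := theta (- (Q / z)) (- (Q ^+ 3 * z)) in
  let D := theta (- (Q * z)) (- (Q ^+ 3 / z)) in
  N != 0 -> D != 0 ->
  1 / (h * (N / D)) - h * (N / D) =
    phi Q * theta (- z) (- (Q ^+ 2 / z)) /
    (h * psi (Q ^+ 2) * theta (- (Q / z)) (- (Q * z))) /\
  1 / (h * (N / D)) + h * (N / D) =
    phi (- Q) * theta z (Q ^+ 2 / z) /
    (h * psi (Q ^+ 2) * theta (- (Q / z)) (- (Q * z))).
Proof.
move=> Q0 z0 Q1 hz N D N0 D0.
have h0 : h != 0 by rewrite -sqrf_eq0 hz.
have y0 : - z != 0 by rewrite oppr_eq0.
have yV (c : R[i]) : c / - z = - (c / z) by rewrite invrN mulrN.
have m2 : (- 1 : R[i]) ^+ 2 = 1 by rewrite sqrrN expr1n.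
have s1 := theta_sqr_add Q0 y0 Q1 (expr1n _ 2).
have s2 := theta_sqr_add Q0 y0 Q1 m2.
have m1 := theta_mul Q0 y0 Q1.
rewrite !yV !mulrN in s1 s2 m1.
rewrite -/N -/D !mul1r in s1; rewrite -/N -/D !mulN1r !opprK in s2.
rewrite -/N -/D in m1.
have := inv_sub_add h0 N0 D0 hz s1 s2 m1.
exact.
Qed.

(** Every exponent in the theorem has the form a k/4 + c n with n = 2i - 1, so every power is a
    monomial in q^(k/4) = w^k and q^n = w^(4n). *)
Lemma qpow_lin (K : numFieldType) (w : K) (k n : nat) (s : rat) (a c : int) :
  w != 0 -> 4 * s = a%:~R * k%:Q + c%:~R * (4 * n%:Q) ->
  qpow w s = (w ^+ k) ^ a * (w ^+ (4 * n)) ^ c.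
Proof.
move=> w0 hs; rewrite (@qpow_int _ _ _ (k%:Z * a + (4 * n)%N%:Z * c)).
  by rewrite expfzDr// !exprnP !exprz_exp.
rewrite hs rmorphD/= !rmorphM/= PoszM rmorphM/=.
by rewrite [k%:Q * _]mulrC [X in _ + X]mulrC.
Qed.

Lemma qpow_half_sqr (K : numFieldType) (w : K) (n : nat) :
  qpow w (n%:Q / 2) ^+ 2 = w ^+ (4 * n).
Proof.
rewrite (@qpow_int _ _ _ (2 * n)%N); last by rewrite PoszM rmorphM/=; field.
by rewrite -exprnP -exprM; congr (_ ^+ _); lia.
Qed.

Theorem theorem1p2 (R : realType) (k m : nat) (i : rat) (q w : R[i])
    (hk : (0 < k)%N) (hk2 : ~~ odd k) (hm : (1 <= m)%N) (hi : i = m%:Q / 2)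
    (hq : 0 < `|q| < 1) (hw : w ^+ 4 = q)
    (hnum : T_num w k i != 0) (hden : T_den w k i != 0) :
  [/\ T w k i =
        qpow w ((2 * i - 1) / 2) *
        (theta (- qpow w (k%:Q / 4 - (2 * i - 1)))
               (- qpow w (3 * k%:Q / 4 + (2 * i - 1))) /
         theta (- qpow w (k%:Q / 4 + (2 * i - 1)))
               (- qpow w (3 * k%:Q / 4 - (2 * i - 1)))),
      1 / T w k i - T w k i =
        (phi (qpow w (k%:Q / 4)) *
         theta (- qpow w (2 * i - 1)) (- qpow w (k%:Q / 2 - (2 * i - 1)))) /
        (qpow w ((2 * i - 1) / 2) * psi (qpow w (k%:Q / 2)) *
         theta (- qpow w (k%:Q / 4 - (2 * i - 1)))
               (- qpow w (k%:Q / 4 + (2 * i - 1)))) &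
      1 / T w k i + T w k i =
        (phi (- qpow w (k%:Q / 4)) *
         theta (qpow w (2 * i - 1)) (qpow w (k%:Q / 2 - (2 * i - 1)))) /
        (qpow w ((2 * i - 1) / 2) * psi (qpow w (k%:Q / 2)) *
         theta (- qpow w (k%:Q / 4 - (2 * i - 1)))
               (- qpow w (k%:Q / 4 + (2 * i - 1))))].
Proof.
have /andP[q0 q1] := hq.
have w0 : w != 0 by apply: contraTneq q0 => w0; rewrite -hw w0 expr0n normr0 ltxx.
have w1 : `|w| < 1.
  by move: q1; rewrite -hw normrX expr_lt1.
(* As m >= 1, 2i - 1 = m - 1 is a natural number. *)
pose n := m.-1; have in1 : 2 * i - 1 = n%:Q.
  rewrite hi mulrC divfK// -(prednK hm) -/n -addn1 PoszD rmorphD/=.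
  by rewrite addrK.
set Q := w ^+ k; set z := w ^+ (4 * n).
have Q0 : Q != 0 by rewrite expf_neq0.
have z0 : z != 0 by rewrite expf_neq0.
have Q1 : `|Q| < 1 by rewrite normrX exprn_ilt1 -?lt0n.
pose h := qpow w ((2 * i - 1) / 2).
have hz : h ^+ 2 = z.
  by rewrite /h in1; exact: qpow_half_sqr.
have e1 : qpow w (k%:Q / 4 - (2 * i - 1)) = Q / z.
  by rewrite (qpow_lin (k := k) (n := n) (a := 1) (c := -1)) ?expr1z ?exprN1// in1; field.
have e2 : qpow w (3 * k%:Q / 4 + (2 * i - 1)) = Q ^+ 3 * z.
  by rewrite (qpow_lin (k := k) (n := n) (a := 3) (c := 1)) ?expr1z// in1; field.
have e3 : qpow w (k%:Q / 4 + (2 * i - 1)) = Q * z.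
  by rewrite (qpow_lin (k := k) (n := n) (a := 1) (c := 1)) ?expr1z// in1; field.
have e4 : qpow w (3 * k%:Q / 4 - (2 * i - 1)) = Q ^+ 3 / z.
  by rewrite (qpow_lin (k := k) (n := n) (a := 3) (c := -1)) ?exprN1// in1; field.
have e5 : qpow w k%:Q = Q ^+ 4.
  by rewrite (qpow_lin (k := k) (n := n) (a := 4) (c := 0)) ?mulr1//; field.
have e6 : qpow w (k%:Q / 2) = Q ^+ 2.
  by rewrite (qpow_lin (k := k) (n := n) (a := 2) (c := 0)) ?mulr1//; field.
have e7 : qpow w (k%:Q / 4) = Q.
  by rewrite (qpow_lin (k := k) (n := n) (a := 1) (c := 0)) ?expr1z ?mulr1//; field.
have e8 : qpow w (2 * i - 1) = z.
  by rewrite (qpow_lin (k := k) (n := n) (a := 0) (c := 1)) ?expr1z ?mul1r// in1; field.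
have e9 : qpow w (k%:Q / 2 - (2 * i - 1)) = Q ^+ 2 / z.
  by rewrite (qpow_lin (k := k) (n := n) (a := 2) (c := -1)) ?exprN1// in1; field.
have Q41 : `|Q ^+ 4| < 1 by rewrite normrX exprn_ilt1.
have C0 := qpoch_neq0 Q41.
have dN : theta (- (Q / z)) (- (Q ^+ 3 * z)) =
    T_num w k i * qpoch (Q ^+ 4) (Q ^+ 4).
  rewrite /T_num e1 e2 e5; apply: theta_qpochs => //.
  - by rewrite mulf_neq0 ?invr_eq0.
  - by rewrite mulf_neq0 ?expf_neq0.
  - by field.
have dD : theta (- (Q * z)) (- (Q ^+ 3 / z)) =
    T_den w k i * qpoch (Q ^+ 4) (Q ^+ 4).
  rewrite /T_den e3 e4 e5; apply: theta_qpochs => //.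
  - by rewrite mulf_neq0.
  - by rewrite mulf_neq0 ?expf_neq0 ?invr_eq0.
  - by field.
(* The factor (Q^4;Q^4)_oo is common to both theta functions and cancels. *)
have TE : T w k i = h * (theta (- (Q / z)) (- (Q ^+ 3 * z)) /
    theta (- (Q * z)) (- (Q ^+ 3 / z))).
  by rewrite dN dD -mulf_div divff// mulr1.
have N0 : theta (- (Q / z)) (- (Q ^+ 3 * z)) != 0 by rewrite dN mulf_neq0.
have D0 : theta (- (Q * z)) (- (Q ^+ 3 / z)) != 0 by rewrite dD mulf_neq0.
have [t1 t2] := theta_quotient Q0 z0 Q1 hz N0 D0.
rewrite e1 e2 e3 e4 e6 e7 e8 e9 -/h TE.
by split; [|exact: t1|exact: t2].
Qed.
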